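(* Let $Q=(X,* )$ be a quandle and let $\{\beta_y\colon X\to X\mid y\in X\}$ be a biquandle structure on $Q$. Define two binary operations on $X$ by $x\,\underline{\ast}\,y=\beta_y(x*y)$ and $x\,\overline{\ast}\,y=\beta_y(x)$ for every $x,y\in X$. Then $B=(X,\underline{\ast},\overline{\ast})$ is a biquandle and $\mathcal{Q}(B)=Q$.
   Context: A quandle is a set $Q$ with a binary operation $*$ such that (1) $x*x=x$ for all $x$; (2) for every $y$ the map $S_y(x)=x*y$ is a bijection of $Q$; (3) $(x*y)*z=(x*z)*(y*z)$ for all $x,y,z$. $Aut(Q)$ is the group of bijective quandle homomorphisms $Q\to Q$. A biquandle is a set $B$ with two binary operations $\underline{\ast},\overline{\ast}$ such that (1) $x\,\underline{\ast}\,x=x\,\overline{\ast}\,x$ for all $x$; (2) the maps $\alpha_y(x)=x\,\underline{\ast}\,y$ and $\beta_y(x)=x\,\overline{\ast}\,y$ (for every $y\in B$) are bijections of $B$, and the map $S(x,y)=(y\,\overline{\ast}\,x,\;x\,\underline{\ast}\,y)$ is a bijection of $B\times B$; (3) for all $x,y,z\in B$: $(x\,\underline{\ast}\,y)\,\underline{\ast}\,(z\,\underline{\ast}\,y)=(x\,\underline{\ast}\,z)\,\underline{\ast}\,(y\,\overline{\ast}\,z)$, $(x\,\underline{\ast}\,y)\,\overline{\ast}\,(z\,\underline{\ast}\,y)=(x\,\overline{\ast}\,z)\,\underline{\ast}\,(y\,\overline{\ast}\,z)$, and $(x\,\overline{\ast}\,y)\,\overline{\ast}\,(z\,\overline{\ast}\,y)=(x\,\overline{\ast}\,z)\,\overline{\ast}\,(y\,\underline{\ast}\,z)$.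 Write $x\,\overline{\ast}^{-1}y=\beta_y^{-1}(x)$. For a biquandle $B=(X,\underline{\ast},\overline{\ast})$, the underlying quandle $\mathcal{Q}(B)=(X,* )$ has operation $x*y=(x\,\underline{\ast}\,y)\,\overline{\ast}^{-1}y$ (this is known to be a quandle). A biquandle structure on a quandle $Q=(X,* )$ is a family of automorphisms $\{\beta_y\mid y\in X\}\subset Aut(Q)$ such that (1) $\beta_{\beta_y(x*y)}\beta_y=\beta_{\beta_x(y)}\beta_x$ for every $x,y\in X$; (2) the map $y\mapsto\beta_y(y)$ is a bijection of $X$. *)

(* Defs.v *)
From mathcomp Require Import all_boot.
From Stdlib Require Import IndefiniteDescription.

Set Implicit Arguments.
Unset Strict Implicit.
Unset Printing Implicit Defensive.

Lemma bijective_ex_inverse (A C : Type) (f : A -> C) :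
  bijective f -> exists g : C -> A, cancel f g /\ cancel g f.
Proof. by case=> g fK gK; exists g. Qed.

(* [bijective] is a proposition, so the (unique) inverse map is extracted by
   description; [A] may be empty. *)
Definition inverse (A C : Type) (f : A -> C) (hf : bijective f) : C -> A :=
  proj1_sig (constructive_indefinite_description _ (bijective_ex_inverse hf)).

Lemma inverseK (A C : Type) (f : A -> C) (hf : bijective f) :
  cancel (inverse hf) f.
Proof. by rewrite /inverse; case: constructive_indefinite_description => g []. Qed.

Lemma inverse_cancel (A C : Type) (f : A -> C) (hf : bijective f) :
  cancel f (inverse hf).
Proof. by rewrite /inverse; case: constructive_indefinite_description => g []. Qed.

Record is_quandle (X : Type) (op : X -> X -> X) : Prop := IsQuandle {
  quandle_idem : forall x, op x x = x;
  quandle_bij : forall y, bijective (fun x => op x y);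
  quandle_dist : forall x y z, op (op x y) z = op (op x z) (op y z)
}.

Record quandle (X : Type) : Type := Quandle {
  qop : X -> X -> X;
  qopP : is_quandle qop
}.

Definition quandle_aut (X : Type) (Q : quandle X) (f : X -> X) : Prop :=
  bijective f /\ (forall x y, f (qop Q x y) = qop Q (f x) (f y)).

Record is_biquandle (X : Type) (under over : X -> X -> X) : Prop :=
  IsBiquandle {
  biquandle_diag : forall x, under x x = over x x;
  biquandle_under_bij : forall y, bijective (fun x => under x y);
  biquandle_over_bij : forall y, bijective (fun x => over x y);
  biquandle_pair_bij :
    bijective (fun p : X * X => (over p.2 p.1, under p.1 p.2));
  biquandle_under_under : forall x y z,
    under (under x y) (under z y) = under (under x z) (over y z);
  biquandle_under_over : forall x y z,
    over (under x y) (under z y) = under (over x z) (over y z);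
  biquandle_over_over : forall x y z,
    over (over x y) (over z y) = over (over x z) (under y z)
}.

Record biquandle (X : Type) : Type := Biquandle {
  bunder : X -> X -> X;
  bover : X -> X -> X;
  biquandleP : is_biquandle bunder bover
}.

Definition bover_inv (X : Type) (B : biquandle X) (x y : X) : X :=
  inverse (biquandle_over_bij (biquandleP B) y) x.

Definition underlying_op (X : Type) (B : biquandle X) (x y : X) : X :=
  bover_inv B (bunder B x y) y.

Lemma bover_underlying_op (X : Type) (B : biquandle X) (x y : X) :
  bover B (underlying_op B x y) y = bunder B x y.
Proof. exact: (inverseK (biquandle_over_bij (biquandleP B) y)). Qed.

Lemma underlying_op_eq (X : Type) (B : biquandle X) (w x y : X) :
  bover B w y = bunder B x y -> underlying_op B x y = w.
Proof.
move=> E; rewrite /underlying_op /bover_inv -E.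
exact: (inverse_cancel (biquandle_over_bij (biquandleP B) y)).
Qed.

Lemma underlying_opP (X : Type) (B : biquandle X) :
  is_quandle (underlying_op B).
Proof.
have [Hd Hu _ _ Huu Huo Hoo] := biquandleP B.
have over_morph x y z : underlying_op B (bover B x z) (bover B y z)
    = bover B (underlying_op B x y) z.
  by apply: underlying_op_eq; rewrite Hoo bover_underlying_op Huo.
have under_morph x y z : underlying_op B (bunder B x z) (bunder B y z)
    = bunder B (underlying_op B x y) z.
  by apply: underlying_op_eq; rewrite Huo bover_underlying_op Huu.
split=> [x|y|x y z].
- by apply: underlying_op_eq; rewrite Hd.
- have [g fK gK] := Hu y.
  exists (fun x => g (bover B x y)) => x; first by rewrite bover_underlying_op.
  by apply: underlying_op_eq; rewrite gK.
- by apply: underlying_op_eq; rewrite -over_morph !bover_underlying_op.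
Qed.

Definition underlying_quandle (X : Type) (B : biquandle X) : quandle X :=
  Quandle (underlying_opP B).

Record biquandle_structure (X : Type) (Q : quandle X) (beta : X -> X -> X) :
    Prop := BiquandleStructure {
  bqs_aut : forall y, quandle_aut Q (beta y);
  (* an equality of maps X -> X, stated pointwise *)
  bqs_comp : forall x y,
    beta (beta y (qop Q x y)) \o beta y =1 beta (beta x y) \o beta x;
  bqs_diag : bijective (fun y => beta y y)
}.

(* Main.v *)
Require Import Defs.
From mathcomp Require Import all_boot.
From Stdlib Require Import FunctionalExtensionality ProofIrrelevance.

(** All three exchange laws reduce to [bqs_comp] because each [beta y] is an
automorphism. For the bijectivity of [S (x, y) = (a, b)], evaluating
[beta b \o beta y = beta a \o beta x] at [y] gives
[beta b (beta y y) = beta a a]; as [y |-> beta y y] is bijective, this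
determines [y] from [a] and [b], then [x] from [b = beta y (x * y)], and
conversely [a] from [y] and [b]. *)

(** A [quandle] bundles its operation with a proof of the axioms, so equality of quandles needs
    proof irrelevance besides equality of operations. *)
Lemma quandle_ext (X : Type) (Q1 Q2 : quandle X) :
  qop Q1 =2 qop Q2 -> Q1 = Q2.
Proof.
case: Q1 Q2 => [op1 op1P] [op2 op2P] /= eq_op.
have {}eq_op : op1 = op2.
  by do 2![apply: functional_extensionality => ?].
by case: op2 / eq_op op2P => op2P; rewrite (proof_irrelevance _ op1P op2P).
Qed.

Section BiquandleStructure.

Variables (X : Type) (Q : quandle X) (beta : X -> X -> X).
Hypothesis hbeta : biquandle_structure Q beta.

Let under x y := beta y (qop Q x y).

Lemma structure_under_bij y : bijective (under^~ y).
Proof.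
have [bij_beta _] := bqs_aut hbeta y.
exact: bij_comp bij_beta (quandle_bij (qopP Q) y).
Qed.

Lemma structure_comp x y w :
  beta (under x y) (beta y w) = beta (beta x y) (beta x w).
Proof. exact: bqs_comp hbeta x y w. Qed.

Lemma structure_pair_bij :
  bijective (fun p : X * X => (beta p.1 p.2, under p.1 p.2)).
Proof.
have [diagV diagK diagVK] := bqs_diag hbeta.
have beta_bij b : bijective (beta b) by case: (bqs_aut hbeta b).
pose snd_of a b := diagV (inverse (beta_bij b) (beta a a)).
pose fst_of y b := inverse (structure_under_bij y) b.
exists (fun q => (fst_of (snd_of q.1 q.2) q.2, snd_of q.1 q.2)).
  move=> [x y] /=.
  have -> : snd_of (beta x y) (under x y) = y.
    by rewrite /snd_of -structure_comp inverse_cancel diagK.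
  by rewrite /fst_of (inverse_cancel (structure_under_bij y)).
move=> [a b] /=; set y := snd_of a b; set x := fst_of y b.
have under_xy : under x y = b by exact: (inverseK (structure_under_bij y)).
(* The diagonal map is injective, so [beta x y = a] may be checked on its values there; [y] was
   chosen so that [beta b (beta y y) = beta a a]. *)
rewrite under_xy; congr pair; apply: (can_inj diagK).
rewrite -structure_comp under_xy.
by rewrite [beta y y]diagVK inverseK.
Qed.

Lemma structure_is_biquandle : is_biquandle under (fun x y => beta y x).
Proof.
have [idem _ dist] := qopP Q.
have morph z x y : beta z (qop Q x y) = qop Q (beta z x) (beta z y).
  by case: (bqs_aut hbeta z).
split.
- by move=> x; rewrite /under idem.
- exact: structure_under_bij.
- by move=> y; case: (bqs_aut hbeta y).
- exact: structure_pair_bij.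
(* Once the inner automorphisms are pulled out of the products, both sides are
   [beta (beta z y) \o beta z] applied to the two sides of self-distributivity. *)
- by move=> x y z; rewrite {1 4}/under -!morph structure_comp -dist.
- by move=> x y z; rewrite structure_comp /under !morph.
- by move=> x y z; rewrite structure_comp.
Qed.

End BiquandleStructure.

Theorem theorem2p3 (X : Type) (Q : quandle X) (beta : X -> X -> X)
  (hbeta : biquandle_structure Q beta) :
  exists HB : is_biquandle (fun x y => beta y (qop Q x y))
                           (fun x y => beta y x),
    underlying_quandle (Biquandle HB) = Q.
Proof.
exists (structure_is_biquandle X Q beta hbeta); apply: quandle_ext => x y.
(* Both sides of the required equation are [beta y (qop Q x y)] by definition. *)
exact: underlying_op_eq.
Qed.
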